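(* For all integers $k\geq 1$ and $d\geq 2k-1$ such that $2(d-2k+1)\equiv 0\pmod{k(k+1)}$, there are infinitely many values of $n$ such that for all integers $0\leq t<k$, $$\alpha_d^t(\mathcal{G}_{n,k})\;\leq\;\left(\frac{d-2k+1}{d-\frac{3}{2}k+1}\right)\left(\frac{t+1}{k+1}\right)n\;+\;\frac{(k-1)(t+1)(d-2k+1)+k(t+1)(k+1)}{(d-\frac{3}{2}k+1)(k+1)}.$$
   Context: All graphs are finite, undirected, and simple. The treewidth of a graph $G$ is the minimum integer $k$ such that $G$ is a subgraph of a chordal graph with no clique on more than $k+1$ vertices. $\mathcal{G}_{n,k}$ denotes the family of $n$-vertex graphs with treewidth $k$ (nonempty exactly when $n\geq k+1$; the values of $n$ in the claim are such that the family is nonempty). For a graph $G$ and integers $t,d\geq 0$, $\alpha_d^t(G)$ denotes the maximum cardinality of a set $S\subseteq V(G)$ such that every vertex of $S$ has degree at most $d$ in $G$ and the induced subgraph $G[S]$ has treewidth at most $t$ (the empty set is allowed as $S$). For a family $\mathcal{G}$ of graphs, $\alpha_d^t(\mathcal{G})$ is the minimum of $\alpha_d^t(G)$ over all $G\in\mathcal{G}$. *)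

(* Defs.v *)
From mathcomp Require Import all_boot all_order all_algebra.
From mathcomp Require Import boolp.

Set Implicit Arguments.
Unset Strict Implicit.
Unset Printing Implicit Defensive.

Record graph := Graph {
  vertex :> finType;
  edge : rel vertex;
  edge_sym : symmetric edge;
  edge_irr : irreflexive edge }.

Definition degree (G : graph) (x : G) : nat := #|[set y | edge x y]|.

Section Induced.
Variables (G : graph) (S : {set G}).

Definition induced_edge : rel {x | x \in S} :=
  fun x y => edge (val x) (val y).

Lemma induced_edge_sym : symmetric induced_edge.
Proof. by move=> x y; exact: edge_sym. Qed.

Lemma induced_edge_irr : irreflexive induced_edge.
Proof. by move=> x; exact: edge_irr. Qed.

Definition induced : graph := Graph induced_edge_sym induced_edge_irr.
End Induced.

(* Up to renaming of vertices; [H] may have more vertices than [G]. *)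
Definition subgraph (G H : graph) : Prop :=
  exists2 f : G -> H, injective f & forall x y, edge x y -> edge (f x) (f y).

Definition clique (G : graph) (K : {set G}) : Prop :=
  {in K &, forall x y, x != y -> edge x y}.

(* [next c x] is the cyclic successor of [x] in [c], so the last two conditions
   say that [x] and [y] are not consecutive on the cycle. *)
Definition has_chord (G : graph) (c : seq G) : Prop :=
  exists x y, [/\ x \in c, y \in c, edge x y, y != next c x & x != next c y].

Definition chordal (G : graph) : Prop :=
  forall c : seq G, ucycle (@edge G) c -> 4 <= size c -> has_chord c.

(* The least element of [P], and the junk value 0 when [P] is empty. *)
Definition nat_min (P : nat -> Prop) : nat :=
  if pselect (exists m, `[< P m >]) is left exP then ex_minn exP else 0.

Lemma nat_minP (P : nat -> Prop) : (exists m, P m) ->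
  P (nat_min P) /\ forall m, P m -> nat_min P <= m.
Proof.
move=> [m Pm]; rewrite /nat_min; case: pselect => [exP|[]]; last first.
  by exists m; apply/asboolP.
case: ex_minnP => p /asboolP Pp minp; split=> // q Pq.
by apply: minp; apply/asboolP.
Qed.

Definition chordal_completion (G : graph) (k : nat) : Prop :=
  exists H : graph, [/\ subgraph G H, chordal H &
    forall K : {set H}, clique K -> #|K| <= k.+1].

(* The minimum is over natural numbers, so the graph without vertices gets
   treewidth 0 instead of -1; this is immaterial for comparisons "treewidth at
   most t" with t >= 0 and "treewidth equal to k" with k >= 1. *)
Definition treewidth (G : graph) : nat := nat_min (chordal_completion G).

Section Complete.
Variable T : finType.

Lemma complete_edge_sym : symmetric [rel x y : T | x != y].
Proof. by move=> x y /=; rewrite eq_sym. Qed.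

Lemma complete_edge_irr : irreflexive [rel x y : T | x != y].
Proof. by move=> x /=; rewrite eqxx. Qed.

Definition complete : graph := Graph complete_edge_sym complete_edge_irr.

Lemma complete_chordal : chordal complete.
Proof.
move=> [|a [|b [|c [|e s]]]] //= /andP[_ U] _; exists a, c.
move: U; rewrite /= !inE !negb_or => /andP[/and4P[ab ac ae as_] U].
case/and3P: U => [/and3P[bc be bs] /andP[ce cs] _].
split; rewrite ?inE ?eqxx ?orbT //=.
  by rewrite eq_sym.
by rewrite [c == a]eq_sym (negPf ac) [c == b]eq_sym (negPf bc).
Qed.
End Complete.

(* The minimum defining [treewidth] is never taken over the empty set. *)
Lemma chordal_completion_ex (G : graph) : exists k, chordal_completion G k.
Proof.
exists #|G|, (complete G); split; last by move=> K _; rewrite leqW ?max_card.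
  by exists id => // x y; apply: contraTneq => ->; rewrite edge_irr.
exact: complete_chordal.
Qed.

Definition alpha (d t : nat) (G : graph) : nat :=
  \max_(S : {set G} |
        [forall x in S, degree x <= d] && (treewidth (induced S) <= t)) #|S|.

Definition alpha_family (d t : nat) (F : graph -> Prop) : nat :=
  nat_min (fun m => exists2 G, F G & alpha d t G = m).

Definition treewidth_family (n k : nat) (G : graph) : Prop :=
  #|G| = n /\ treewidth G = k.

(* Main.v *)
(** Write [2 (d - 2k + 1) = r k (k + 1)].  The extremal graph is the [k]-th power
    of a path on [W + k + 3] vertices, to which [r] new [(k+1)]-cliques are attached
    at each of [W] windows of [k] consecutive path vertices: the [i]-th vertex of a
    new clique is joined to the first [k - i] vertices of its window.  Eliminating
    new vertices first shows that this graph is chordal, and it is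
    [(k+1)]-colourable, so it has treewidth [k].  A path vertex other than the
    first and the last [k + 1] ones has [2k] neighbours on the path and
    [r k (k + 1) / 2] new ones, hence degree [d + 1].  The vertices of degree at
    most [d] are therefore covered by [W r + 2] cliques, each of which contains at
    most [t + 1] vertices of a set inducing treewidth at most [t]. *)
Require Import Defs.
From mathcomp Require Import all_boot all_order all_algebra.
From mathcomp Require Import zify ring lra.
Import GRing.Theory Num.Theory Order.POrderTheory.

Set Implicit Arguments.
Unset Strict Implicit.
Unset Printing Implicit Defensive.

(** * Treewidth, cliques and elimination orders *)

Lemma treewidth_le (G : graph) k : chordal_completion G k -> treewidth G <= k.
Proof.
by move=> Gk; have [_] := nat_minP (chordal_completion_ex G); apply.
Qed.

Lemma clique_le_treewidth (G : graph) (K : {set G}) :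
  clique K -> #|K| <= (treewidth G).+1.
Proof.
move=> cK; have [[H [[f f_inj fE] _ cliqueH]] _] :=
  nat_minP (chordal_completion_ex G).
rewrite -(card_imset (mem K) f_inj); apply: cliqueH.
move=> _ _ /imsetP[x xK ->] /imsetP[y yK ->] fxy.
by apply/fE/cK => //; apply: contraNneq fxy => ->.
Qed.

Lemma clique_induced (G : graph) (S K : {set G}) t :
  clique K -> K \subset S -> treewidth (induced S) <= t -> #|K| <= t.+1.
Proof.
move=> cK /subsetP KS twS.
pose K' : {set induced S} := [set x | val x \in K].
have -> : #|K| = #|K'|.
  rewrite -(card_imset (mem K') val_inj); apply: eq_card => x.
  apply/idP/imsetP => [xK|[y]]; last by rewrite inE => yK ->.
  by exists (exist _ x (KS x xK) : induced S); rewrite ?inE.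
apply: leq_trans (clique_le_treewidth _) _ => // x y.
by rewrite !inE => xK yK xy; apply: cK.
Qed.

(** On a cycle, both cycle neighbours of a vertex of maximal rank have smaller rank, so they are
    adjacent. On a cycle of length at least 4 this edge is a chord. *)
Lemma chordal_of_elimination (G : graph) (rank : G -> nat) :
    (forall x y, edge x y -> rank x != rank y) ->
    (forall v x y, edge v x -> edge v y -> rank x < rank v -> rank y < rank v ->
       x != y -> edge x y) ->
  chordal G.
Proof.
move=> rankE elim c /andP[cyc_c uniq_c] size_c.
have [a ac] : exists a, a \in c.
  by case: c size_c {cyc_c uniq_c} => // a c _; exists a; exact: mem_head.
have [v vc vmax] := @arg_maxnP _ a (mem c) rank ac.
have [i s rot_c] := rot_to vc.
have mem_c : c =i v :: s by move=> x; rewrite -rot_c mem_rot.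
have next_c : next c =1 next (v :: s) by move=> x; rewrite -rot_c next_rot.
have cyc : cycle (@edge G) (v :: s) by rewrite -rot_c rot_cycle.
have uniq_s : uniq (v :: s) by rewrite -rot_c rot_uniq.
have size_s : 3 < size (v :: s) by rewrite -rot_c size_rot.
have lower x : x \in v :: s -> edge v x -> rank x < rank v.
  rewrite -mem_c => xc vx; rewrite ltn_neqAle eq_sym rankE //=; exact: vmax.
case: s => [|y [|z [|w s]]] // in mem_c next_c cyc uniq_s size_s lower {rot_c} *.
set s' := [:: v, y, z, w & s] in mem_c next_c cyc uniq_s lower *.
have vy : edge v y by case/andP: cyc.
have v_s : v \in s' by rewrite mem_head.
have y_s : y \in s' by rewrite !inE eqxx orbT.
have x_s : prev s' v \in s' by rewrite mem_prev.
have vx : edge v (prev s' v) by rewrite edge_sym; apply: prev_cycle.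
have next_x : next s' (prev s' v) = v by apply: next_prev.
move: (uniq_s); rewrite /= !inE !negb_or.
case/andP=> /and4P[nvy nvz nvw _] /andP[/and3P[nyz nyw _] /andP[/andP[nzw _] _]].
have next_y : next s' y = z.
  by rewrite /s' /= [y == v]eq_sym (negPf nvy) eqxx.
have next_z : next s' z = w.
  by rewrite /s' /= [z == v]eq_sym (negPf nvz) [z == y]eq_sym (negPf nyz) eqxx.
(* Here the length enters: the successor of [z] is the fourth vertex [w], not [v]. *)
have xz : prev s' v != z.
  by apply: contraNneq nvw => xz; rewrite -next_x xz next_z.
have xy : prev s' v != y.
  by apply: contraNneq nvz => xy; rewrite -next_x xy next_y.
exists (prev s' v), y; split; rewrite ?mem_c ?next_c ?next_x ?next_y //.
  by apply: (elim v) => //; apply: lower.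
by rewrite eq_sym.
Qed.

Lemma clique_le_colors (G : graph) (C : finType) (col : G -> C) (K : {set G}) :
  (forall x y, edge x y -> col x != col y) -> clique K -> #|K| <= #|C|.
Proof.
move=> colE cK; rewrite -(@card_in_imset _ _ col (mem K)) ?max_card //.
move=> x y xK yK eq_col; apply: contraTeq isT => xy.
by have /colE := cK x y xK yK xy; rewrite eq_col eqxx.
Qed.

(** The fibres of [g] on the vertices of degree at most [d] are cliques, and an admissible set meets
    each of them in at most [t + 1] vertices. *)
Lemma alpha_le_clique_cover (G : graph) (P : finType) (g : G -> P) d t :
    (forall x y, degree x <= d -> degree y <= d -> g x = g y -> x != y ->
       edge x y) ->
  alpha d t G <= t.+1 * #|P|.
Proof.
move=> gE; apply/bigmax_leqP => S /andP[/forall_inP lowS twS].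
rewrite -sum1_card (partition_big g predT) //= mulnC -sum_nat_const.
apply: leq_sum => p _; rewrite sum1dep_card.
apply: (@clique_induced _ S) => //.
  move=> x y; rewrite !inE => /andP[xS /eqP gx] /andP[yS /eqP gy].
  by apply: gE; rewrite ?lowS // gx gy.
by apply/subsetP => x; rewrite inE => /andP[].
Qed.

Lemma alpha_family_le d t (F : graph -> Prop) G :
  F G -> alpha_family d t F <= alpha d t G.
Proof.
move=> FG; have ex : exists m, exists2 G, F G & alpha d t G = m.
  by exists (alpha d t G), G.
by have [_] := nat_minP ex; apply; exists G.
Qed.

(** A pair [(p, i)] stands for the window vertex at offset [p] and the [i]-th vertex of a new
    clique; the set selects the adjacent pairs. *)
Definition triangle k : {set 'I_k * 'I_k.+1} := [set p : 'I_k * 'I_k.+1 | p.1 + p.2 < k].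

(* Reversing both coordinates exchanges the triangle and its complement. *)
Lemma card_triangle k : 2 * #|triangle k| = k * k.+1.
Proof.
pose f (p : 'I_k * 'I_k.+1) := (rev_ord p.1, rev_ord p.2).
have f_inj : injective f.
  by move=> [a b] [c e] [] eq1 eq2; congr pair; apply: rev_ord_inj; apply: val_inj.
have <- : #|[set: 'I_k * 'I_k.+1]| = k * k.+1.
  by rewrite cardsT card_prod !card_ord.
rewrite cardsT -(cardsC (triangle k)) mul2n -addnn; congr addn.
rewrite -(card_imset _ f_inj); apply: eq_card => -[a b].
have -> : (a, b) = f (rev_ord a, rev_ord b) by rewrite /f !rev_ordK.
rewrite mem_imset // !inE /=.
by have := ltn_ord a; have := ltn_ord b; lia.
Qed.

(** * The extremal graph *)

Section PathPower.
Variables k r W : nat.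

(** [inl a] is a path vertex; [inr (w, c, i)] is the [i]-th vertex of the [c]-th clique attached to
    window [w]. *)
Definition pp_vertex : finType := ('I_(W + k + 3) + 'I_W * 'I_r * 'I_k.+1)%type.

(* The window with index [w] starts at the path vertex [w + 2]. *)
Definition pp_edge (x y : pp_vertex) : bool :=
  match x, y with
  | inl a, inl b => [&& a != b, a <= b + k & b <= a + k]
  | inl a, inr (w, _, i) | inr (w, _, i), inl a =>
      (w + 2 <= a) && (a + i < w + 2 + k)
  | inr (u, i), inr (v, j) => (u == v) && (i != j)
  end.

Lemma pp_edge_sym : symmetric pp_edge.
Proof.
move=> [a|[[w c] i]] [b|[[w' c'] j]] //=; first by rewrite eq_sym [X in _ && X]andbC.
by rewrite eq_sym [i == j]eq_sym.
Qed.

Lemma pp_edge_irr : irreflexive pp_edge.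
Proof. by move=> [a|[[w c] i]] /=; rewrite !eqxx ?andbF. Qed.

Definition path_power : graph := Graph pp_edge_sym pp_edge_irr.

Lemma card_path_power : #|path_power| = W + k + 3 + W * r * k.+1.
Proof. by rewrite card_sum !card_prod !card_ord. Qed.

Lemma chordal_path_power : chordal path_power.
Proof.
(* New vertices come after the path, ordered by their index [i]. The neighbourhoods on the window
   shrink as [i] grows, so the path neighbours of a new vertex are also joined to the earlier
   vertices of its clique. *)
pose rank (x : path_power) : nat :=
  match x with inl a => a | inr (_, i) => W + k + 3 + i end.
apply: (@chordal_of_elimination _ rank).
  move=> [a|[[w c] i]] [b|[[w' c'] j]] //=; rewrite /edge /=.
  - by case/andP.
  - by have := ltn_ord a; lia.
  - by have := ltn_ord b; lia.
  - by rewrite eqn_add2l => /andP[].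
move=> [a|[[w c] i]] [b|[[w1 c1] j]] [e|[[w2 c2] l]] //=; rewrite /edge /=;
  rewrite ?xpair_eqE.
- by move=> ? ? ? ? be; apply/and3P; split; [exact: be | lia | lia].
- by have := ltn_ord a; lia.
- by have := ltn_ord a; lia.
- by have := ltn_ord a; lia.
- by move=> ? ? ? ? be; apply/and3P; split; [exact: be | lia | lia].
- by move=> ? /andP[/andP[/eqP<- _] _] ? ? _; lia.
- by move=> /andP[/andP[/eqP<- _] _] ? ? ? _; lia.
- move=> /andP[/andP[/eqP<- /eqP<-] _] /andP[/andP[/eqP<- /eqP<-] _] _ _ ne.
  by rewrite !eqxx; apply: contraNneq ne => ->.
Qed.

(* A new vertex gets the colour of the first path vertex after its neighbours. *)
Lemma path_power_coloring (col := fun x : path_power => inord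
    (match x with inl a => a : nat | inr (w, _, i) => w + 2 + k - i end %% k.+1)
    : 'I_k.+1) x y :
  edge x y -> col x != col y.
Proof.
(* Before reduction modulo [k + 1], the numbers at the two ends of any edge differ by at least 1 and
   at most [k]. *)
have modE a b : a < b <= a + k -> inord (a %% k.+1) != inord (b %% k.+1) :> 'I_k.+1.
  move=> /andP[ab ba]; apply/eqP => /(congr1 val) /=.
  rewrite !inordK ?ltn_pmod // => /esym/eqP; rewrite eqn_mod_dvd ?(ltnW ab) //.
  by move/dvdn_leq; lia.
have modE' a b : a != b -> a <= b + k -> b <= a + k ->
    inord (a %% k.+1) != inord (b %% k.+1) :> 'I_k.+1.
  move=> ne ab ba; have [lt|lt|eq] := ltngtP a b; last by rewrite eq eqxx in ne.
    by apply: modE; lia.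
  by rewrite eq_sym; apply: modE; lia.
case: x y => [a|[[w c] i]] [b|[[w' c'] j]]; rewrite /edge /=.
- by case/and3P=> ne ? ?; apply: modE'.
- by move=> ?; apply: modE'; lia.
- by move=> ?; apply: modE'; lia.
- rewrite xpair_eqE => /andP[/andP[/eqP<- _] ne].
  have := ltn_ord i; have := ltn_ord j => ? ?.
  have {}ne : (i : nat) != j by [].
  by apply: modE'; lia.
Qed.

Lemma treewidth_path_power : treewidth path_power = k.
Proof.
apply/eqP; rewrite eqn_leq; apply/andP; split.
  apply: treewidth_le; exists path_power; split.
  - by exists id.
  - exact: chordal_path_power.
  - by move=> K /(clique_le_colors path_power_coloring); rewrite card_ord.
have le : k.+1 <= W + k + 3 by lia.
(* The first [k + 1] path vertices form a clique. *)
pose f (i : 'I_k.+1) : path_power := inl (widen_ord le i).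
have f_inj : injective f by move=> i j [] /val_inj.
rewrite -ltnS -{1}(card_ord k.+1) -cardsT -(card_imset _ f_inj).
apply: clique_le_treewidth => _ _ /imsetP[i _ ->] /imsetP[j _ ->] ij.
rewrite /edge /=; apply/and3P; split; last 2 first.
- by have := ltn_ord i; lia.
- by have := ltn_ord j; lia.
- by apply: contraNneq ij => ij; rewrite /f ij.
Qed.

(** For every [p < k], the vertex [a] has offset [p] in window [a - 2 - p]. The bounds on [a] ensure
    that all these windows exist and that [a] has [k] path vertices on either side. *)
Lemma degree_path_power (a : 'I_(W + k + 3)) : 0 < k -> k < a < W + 2 ->
  2 * k + r * #|triangle k| <= degree (inl a : path_power).
Proof.
move=> k_gt0 /andP[ka aW].
have W_gt0 : a - 2 < W by lia.
(* The boolean chooses the side of [a]. The default of [insubd] is never taken, as [oldE] shows;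
   likewise for [new] and [newE]. *)
pose old (x : bool * 'I_k) : path_power :=
  inl (insubd a (if x.1 then a + x.2.+1 else a - x.2.+1)).
have oldE (b : bool) (p : 'I_k) :
    val (insubd a (if b then a + p.+1 else a - p.+1)) =
    if b then a + p.+1 else a - p.+1 :> nat.
  by rewrite insubdK // unfold_in; have := ltn_ord p; case: b; lia.
have old_inj : injective old.
  move=> [b p] [c q] [/(congr1 val)]; rewrite !oldE => eq_v.
  have bc : b = c by have := ltn_ord p; have := ltn_ord q; case: b c eq_v => -[]; lia.
  rewrite bc in eq_v *; congr pair; apply: val_inj => /=.
  by have := ltn_ord p; have := ltn_ord q; case: c eq_v {bc}; lia.
pose new (x : 'I_r * ('I_k * 'I_k.+1)) : path_power :=
  inr (insubd (Ordinal W_gt0) (a - 2 - x.2.1), x.1, x.2.2).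
have newE (p : 'I_k) : val (insubd (Ordinal W_gt0) (a - 2 - p)) = a - 2 - p :> nat.
  by rewrite insubdK // unfold_in; lia.
have new_inj : injective new.
  move=> [c [p i]] [e [q j]] [/(congr1 val)]; rewrite !newE => eq_v -> ->.
  do 2!congr pair; apply: val_inj => /=.
  by have := ltn_ord p; have := ltn_ord q; lia.
pose is_old (x : path_power) := if x is inl _ then true else false.
rewrite /degree -(cardsID [set x | is_old x]) leq_add //.
  have -> : 2 * k = #|[set: bool * 'I_k]|.
    by rewrite cardsT card_prod card_bool card_ord.
  rewrite -(card_imset _ old_inj); apply/subset_leq_card/subsetP.
  move=> _ /imsetP[[b p] _ ->]; rewrite !inE /= andbT /edge /=.
  have := oldE b p; move: (insubd _ _) => v /= vE.
  have := ltn_ord p => ?; apply/and3P; split; last 2 first.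
  - by case: b vE; lia.
  - by case: b vE; lia.
  - by apply/eqP => /(congr1 val) /=; case: b vE; lia.
have -> : r * #|triangle k| = #|setX [set: 'I_r] (triangle k)|.
  by rewrite cardsX cardsT card_ord.
rewrite -(card_imset _ new_inj); apply/subset_leq_card/subsetP.
move=> _ /imsetP[[c [p i]] pi ->]; move: pi; rewrite !inE /= /edge /= => pi.
by have := newE p; move: (insubd _ _) => v /= vE; have := ltn_ord p; lia.
Qed.

Lemma alpha_path_power d t : 0 < k -> d < 2 * k + r * #|triangle k| ->
  alpha d t path_power <= t.+1 * (2 + W * r).
Proof.
move=> k_gt0 dlt.
(* The path is cut after vertex [k]. Beyond the cut, only the last [k + 1] vertices can have degree
   at most [d], and they form a clique. *)
pose g (x : path_power) : bool + 'I_W * 'I_r :=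
  match x with inl a => inl (a <= k) | inr (u, _) => inr u end.
have -> : 2 + W * r = #|{: bool + 'I_W * 'I_r}|.
  by rewrite card_sum card_prod card_bool !card_ord.
have lowE (a : 'I_(W + k + 3)) : degree (inl a : path_power) <= d ->
    (a <= k) || (W + 2 <= a).
  move=> low; apply: contraTT isT => mid.
  by have /(degree_path_power k_gt0) : k < a < W + 2 by [lia]; lia.
apply: (@alpha_le_clique_cover _ _ g) => -[a|[u i]] [b|[v j]] //=.
- move=> /lowE la /lowE lb [ab] ne; rewrite /edge /=; apply/and3P.
  by have := ltn_ord a; have := ltn_ord b; split; [exact: ne | lia | lia].
- move=> _ _ [<-] ne; rewrite /edge /= eqxx.
  by case: u => w c in ne *; apply: contraNneq ne => ->.
Qed.
End PathPower.

(** * The claimed bound as an exact count *)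

Lemma bound_path_powerE (F : realFieldType) (k r W t d n : nat) : 0 < k ->
    2 * (d + 1) = 4 * k + r * (k * (k + 1)) -> n = W + k + 3 + W * r * k.+1 ->
  ((t.+1 * (2 + W * r))%:R =
     ((d%:R - 2 * k%:R + 1) / (d%:R - 3 / 2 * k%:R + 1)) *
       ((t%:R + 1) / (k%:R + 1)) * n%:R +
     ((k%:R - 1) * (t%:R + 1) * (d%:R - 2 * k%:R + 1) +
        k%:R * (t%:R + 1) * (k%:R + 1)) /
       ((d%:R - 3 / 2 * k%:R + 1) * (k%:R + 1)) :> F)%R.
Proof.
move=> k_gt0 /(congr1 (fun n => n%:R : F)%R) dE ->.
have {}dE : (d%:R = 2 * k%:R - 1 + r%:R * k%:R * (k%:R + 1) / 2 :> F)%R by lra.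
have k0 : (0 < k%:R :> F)%R by rewrite ltr0n.
have r0 : (0 <= r%:R :> F)%R by rewrite ler0n.
rewrite dE.
field.
apply/andP; split; apply: lt0r_neq0; first by lra.
(* This is twice the denominator [d - 3k/2 + 1]; the factored form shows that it is positive. *)
have -> : ((2 * k%:R - 1) * 2 + r%:R * k%:R * (k%:R + 1) - 3 * k%:R + 2 =
           k%:R * (r%:R * (k%:R + 1) + 1) :> F)%R by ring.
by apply: mulr_gt0 => //; apply: ltr_wpDl => //; apply: mulr_ge0 => //; lra.
Qed.

Theorem theorem6 (k d : nat) (hk : 1 <= k) (hd : 2 * k - 1 <= d)
    (hmod : 2 * (d + 1 - 2 * k) = 0 %[mod k * (k + 1)]) :
  forall N : nat, exists n : nat,
    [/\ N <= n,
        exists G : graph, treewidth_family n k G &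
        forall t : nat, t < k ->
          ((alpha_family d t (treewidth_family n k))%:R <=
             ((d%:R - 2 * k%:R + 1) / (d%:R - 3 / 2 * k%:R + 1)) *
               ((t%:R + 1) / (k%:R + 1)) * n%:R +
             ((k%:R - 1) * (t%:R + 1) * (d%:R - 2 * k%:R + 1) +
                k%:R * (t%:R + 1) * (k%:R + 1)) /
               ((d%:R - 3 / 2 * k%:R + 1) * (k%:R + 1)) :> rat)%R].
Proof.
(* The given lower bound on [n] serves as the number of windows. *)
move=> W.
have /dvdnP[r rE] : k * (k + 1) %| 2 * (d + 1 - 2 * k).
  by rewrite /dvdn hmod mod0n.
have famG : treewidth_family (W + k + 3 + W * r * k.+1) k (path_power k r W).
  by split; [exact: card_path_power | exact: treewidth_path_power].
exists (W + k + 3 + W * r * k.+1); split; first by lia.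
  by exists (path_power k r W).
move=> t _.
(* The right-hand side equals [d + 1]: by [hd] the subtraction in [rE] is not truncated, and the
   triangle has [k (k + 1) / 2] elements. *)
have dlt : d < 2 * k + r * #|triangle k|.
  have tri : 2 * (r * #|triangle k|) = r * (k * (k + 1)).
    by rewrite mulnCA card_triangle addn1.
  by move: tri rE hd; move: (r * _) (r * _) => p q; lia.
have alpha_le := leq_trans (alpha_family_le d t famG) (alpha_path_power W t hk dlt).
rewrite -(@bound_path_powerE rat k r W) //; first by rewrite ler_nat.
lia.
Qed.
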